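(* Let $Q$ be a polynomial ring over a field and let $I$ be a monomial ideal of $Q$. Then $Q/I$ has a pivot resolution, and any pivot resolution of $Q/I$ has the structure of a DG-algebra over $Q$.
   Context: Notation. $[q]=\{1,\dots,q\}$, $\mathcal{P}([q])$ is its power set. Let $m_1,\dots,m_q$ be the minimal monomial generators of $I$. For $A\subseteq[q]$ put $m_A=\operatorname{lcm}(m_i : i\in A)$, with $m_\emptyset=1$. Taylor resolution. $\mathcal{T}$ is the complex of free $Q$-modules whose degree-$i$ component has basis $\{\epsilon_\tau : \tau\in\mathcal{P}([q]),\ |\tau|=i\}$, with differential $\partial(\epsilon_\tau)=\sum_{j\in\tau}(-1)^{|\{k\in\tau : k<j\}|}\frac{m_\tau}{m_{\tau\setminus\{j\}}}\epsilon_{\tau\setminus\{j\}}$. It is a free resolution of $Q/I$. Pivot complexes. If $\Omega\subseteq\mathcal{P}([q])$ is closed under taking subsets, $\mathcal{T}_\Omega$ denotes the subcomplex of $\mathcal{T}$ spanned over $Q$ by $\{\epsilon_\tau:\tau\in\Omega\}$. $\mathcal{T}_\Omega$ is a pivot complex of $Q/I$ if either $\Omega=\mathcal{P}([q])$, or there are an integer $l\ge 2$ and indices $i_1<\dots<i_l$ in $[q]$ with $\Omega=\{\sigma\in\mathcal{P}([q]) : \sigma\nsupseteq\{i_1,\dots,i_l\}\}$. A pivot resolution of $Q/I$ is a pivot complex that is a free resolution of $Q/I$ (i.e. $H_0=Q/I$ and $H_i=0$ for $i>0$). DG-algebra structure. A complex $(F,\partial)$ of $Q$-modules with $F_i=0$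 for $i<0$ is a DG-algebra over $Q$ if it is equipped with a $Q$-bilinear multiplication $\star$ with $F_i\star F_j\subseteq F_{i+j}$ and a unit element $1\in F_0$ such that for all homogeneous $a,b,c\in F$ (with $|a|$ the homological degree): $a\star1=1\star a=a$; $a\star b=(-1)^{|a||b|}b\star a$, and $a\star a=0$ if $|a|$ is odd; $(a\star b)\star c=a\star(b\star c)$; and $\partial(a\star b)=\partial(a)\star b+(-1)^{|a|}a\star\partial(b)$. *)

(* Defs.v *)
From HB Require Import structures.
From mathcomp Require Import all_boot all_order all_algebra.
From mathcomp Require Import mpoly.

Set Implicit Arguments.
Unset Strict Implicit.
Unset Printing Implicit Defensive.

Import GRing.Theory.
Local Open Scope ring_scope.

(* A nonnegatively graded complex is given by its total module [F], the
   predicates [Fd i] cutting out the components F_i of F = (+)_i F_i, and the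
   total differential [d]. *)
Section Complexes.

Variables (R : comNzRingType) (F : lmodType R).
Variables (Fd : nat -> F -> Prop) (d : F -> F).

Record is_graded : Prop := IsGraded {
  graded_0 : forall i, Fd i 0;
  graded_lin : forall i r a b, Fd i a -> Fd i b -> Fd i (r *: a + b);
  graded_span : forall a, exists N (c : nat -> F),
    (forall i, Fd i (c i)) /\ a = \sum_(i < N) c i;
  graded_direct : forall N (c : nat -> F), (forall i, Fd i (c i)) ->
    \sum_(i < N) c i = 0 -> forall i, (i < N)%N -> c i = 0 }.

Record is_complex : Prop := IsComplex {
  complex_graded : is_graded;
  complex_linear : forall r a b, d (r *: a + b) = r *: d a + d b;
  complex_deg : forall i a, Fd i.+1 a -> Fd i (d a);
  complex_deg0 : forall a, Fd 0%N a -> d a = 0;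
  complex_dd : forall a, d (d a) = 0 }.

Definition free_component (i : nat) : Prop :=
  exists r (b : 'I_r -> F), (forall j, Fd i (b j)) /\
    forall a, Fd i a -> exists! c : {ffun 'I_r -> R}, a = \sum_j c j *: b j.

(* An isomorphism H_0 = R/I amounts to a surjection F_0 -> R/I with kernel
   d(F_1); as F_0 is free, this surjection lifts to a linear map [e] into R. *)
Definition H0_is_quotient (I : R -> Prop) : Prop :=
  exists e : {linear F -> R^o},
    (forall x : R, exists2 a, Fd 0%N a & I (x - e a)) /\
    (forall a, Fd 0%N a -> (I (e a) <-> exists2 b, Fd 1%N b & a = d b)).

Record is_free_resolution (I : R -> Prop) : Prop := IsFreeResolution {
  resolution_complex : is_complex;
  resolution_free : forall i, free_component i;
  resolution_H0 : H0_is_quotient I;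
  resolution_exact : forall i a, Fd i.+1 a -> d a = 0 ->
    exists2 b, Fd i.+2 b & a = d b }.

Record is_dg_algebra (mul : F -> F -> F) (one : F) : Prop := IsDGAlgebra {
  dga_complex : is_complex;
  dga_linl : forall r a a' b, mul (r *: a + a') b = r *: mul a b + mul a' b;
  dga_linr : forall r a b b', mul a (r *: b + b') = r *: mul a b + mul a b';
  dga_deg : forall i j a b, Fd i a -> Fd j b -> Fd (i + j)%N (mul a b);
  dga_one : Fd 0%N one;
  dga_mul1 : forall i a, Fd i a -> mul a one = a /\ mul one a = a;
  dga_comm : forall i j a b, Fd i a -> Fd j b ->
    mul a b = (-1) ^+ (i * j) *: mul b a;
  dga_sqr0 : forall i a, Fd i a -> odd i -> mul a a = 0;
  dga_assoc : forall i j l a b c, Fd i a -> Fd j b -> Fd l c ->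
    mul (mul a b) c = mul a (mul b c);
  dga_leibniz : forall i j a b, Fd i a -> Fd j b ->
    d (mul a b) = mul (d a) b + (-1) ^+ i *: mul a (d b) }.

Definition has_dg_algebra_structure : Prop :=
  exists (mul : F -> F -> F) (one : F), is_dg_algebra mul one.

End Complexes.

Section MonomialIdeals.

Variables (k : fieldType) (n : nat).
Local Notation Q := {mpoly k[n]}.

Definition monomial_span (S : 'X_{1..n} -> Prop) (f : Q) : Prop :=
  exists r (g : 'I_r -> Q) (s : 'I_r -> 'X_{1..n}),
    (forall j, S (s j)) /\ f = \sum_j g j * 'X_[s j].

Definition monomial_ideal (I : Q -> Prop) : Prop :=
  exists S : 'X_{1..n} -> Prop, forall f, I f <-> monomial_span S f.

Definition minimal_generators (I : Q -> Prop) q (m : 'I_q -> 'X_{1..n}) : Prop :=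
  (forall f, I f <-> monomial_span (fun u => exists i, u = m i) f) /\
  (forall i, ~ monomial_span (fun u => exists2 j, j != i & u = m j) 'X_[m i]).

End MonomialIdeals.

Section Taylor.

Variables (k : fieldType) (n q : nat) (m : 'I_q -> 'X_{1..n}).
Local Notation Q := {mpoly k[n]}.

Definition mlcm_set (A : {set 'I_q}) : 'X_{1..n} :=
  \big[@mlcm n/0%MM]_(i in A) m i.

Section Subcomplex.

Variable Omega : {set {set 'I_q}}.

(* The free Q-module on Omega. The regular module Q^o is needed for [*:] to be
   multiplication by elements of Q rather than of k. *)
Definition taylor_mod := {ffun {s : {set 'I_q} | s \in Omega} -> Q^o}.

(* Zero when [t] is not in Omega; this does not occur in [taylor_diff] when
   Omega is closed under taking subsets. *)
Definition taylor_eps (t : {set 'I_q}) : taylor_mod :=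
  [ffun s => (val s == t)%:R].

Definition taylor_deg (i : nat) (a : taylor_mod) : Prop :=
  forall s, a s != 0 -> #|val s| = i.

(* [mlcm_set t - mlcm_set (t :\ j)] is the exponent of an exact quotient. *)
Definition taylor_diff (a : taylor_mod) : taylor_mod :=
  \sum_s a s *: \sum_(j in val s)
    ((-1) ^+ #|[set l in val s | (l < j)%N]|
       * 'X_[(mlcm_set (val s) - mlcm_set (val s :\ j))%MM] : Q)
    *: taylor_eps (val s :\ j).

End Subcomplex.

Definition is_pivot (Omega : {set {set 'I_q}}) : Prop :=
  Omega = [set: {set 'I_q}] \/
  exists2 S : {set 'I_q}, (2 <= #|S|)%N &
    Omega = [set s : {set 'I_q} | ~~ (S \subset s)].

Definition is_pivot_resolution (I : Q -> Prop) (Omega : {set {set 'I_q}}) : Prop :=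
  is_pivot Omega /\
  is_free_resolution (@taylor_deg Omega) (@taylor_diff Omega) I.

End Taylor.

(* Main.v *)
Require Import Defs.
From HB Require Import structures.
From mathcomp Require Import all_boot all_order all_algebra.
From mathcomp Require Import mpoly ring.
From Stdlib Require Import Classical_Prop.

(** The map [eps_t |-> X^(lcm t) e_t] embeds the Taylor complex, as a complex
with its classical product, into the exterior algebra [E] over [Q] on generators
[e_1, ..., e_q], whose differential is contraction with (1, ..., 1). The image
consists of the [x] such that every monomial of the coefficient at [t] is
divisible by [X^(lcm t)], so the DG identities only have to be checked in [E],
where they follow from [d (e_i y) = y - e_i (d y)]. The same identity makes the
Taylor complex exact: sort monomials [u] by a chosen generator [m_v] dividing
[u], and multiply by [e_v].

Let [S] define a pivot complex [T'], spanned by the [eps_s] with [S] not in [s].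
If [T'] is exact, then the cycle [d eps_S] bounds in [T'], and comparing with
exactness of the full Taylor complex [T] gives some [v] outside [S] with [m_v]
dividing [lcm S]. Let [J] be the span of the [eps_s] and [d eps_s] with
[S + v] contained in [s]; it is a DG ideal and [T] is the direct sum of [T'] and
[J]. Hence [T'] is isomorphic to [T / J], i.e. its product is the product of [T]
followed by the projection [retract] along [J]. *)

Set Implicit Arguments.
Unset Strict Implicit.
Unset Printing Implicit Defensive.

Import GRing.Theory.
Local Open Scope ring_scope.

(** * The exterior algebra with its contraction *)

Section ExteriorAlgebra.

Variables (R : comNzRingType) (q : nat).
Local Notation set_q := {set 'I_q}.

Definition ext := {ffun set_q -> R^o}.
HB.instance Definition _ := GRing.Lmodule.on ext.

Definition ebas (s : set_q) : ext := [ffun t => (t == s)%:R].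

Lemma ext_scaleE c (x : ext) s : (c *: x) s = c * x s.
Proof. by rewrite ffunE. Qed.

Lemma ext_sumE (I : Type) (r : seq I) (P : pred I) (F : I -> ext) s :
  (\sum_(i <- r | P i) F i) s = \sum_(i <- r | P i) F i s.
Proof. exact: sum_ffunE. Qed.

Lemma ebasE s t : ebas s t = (t == s)%:R.
Proof. by rewrite ffunE. Qed.

Lemma ext_expand (x : ext) : x = \sum_s x s *: ebas s.
Proof.
apply/ffunP => t; rewrite ext_sumE (bigD1 t) //= ext_scaleE ebasE eqxx mulr1.
rewrite big1 ?addr0 // => s nst; rewrite ext_scaleE ebasE eq_sym (negbTE nst).
by rewrite mulr0.
Qed.

(** Keeping [x s != 0] in the basis case lets a degree hypothesis on [x] determine the cardinality
    of [s]. *)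
Lemma ext_ind_supp (P : ext -> Prop) (x : ext) :
  P 0 -> (forall y z, P y -> P z -> P (y + z)) ->
  (forall s, x s != 0 -> P (x s *: ebas s)) -> P x.
Proof.
move=> P0 PD Pb; rewrite [x]ext_expand; elim/big_ind: _ => // s _.
by have [->|/Pb//] := eqVneq (x s) 0; rewrite scale0r.
Qed.

Lemma ext_ind (P : ext -> Prop) :
  P 0 -> (forall y z, P y -> P z -> P (y + z)) ->
  (forall c s, P (c *: ebas s)) -> forall x, P x.
Proof. by move=> P0 PD Pb x; apply: ext_ind_supp. Qed.

Definition ext_lin (V : lmodType R) (F : set_q -> V) (x : ext) : V :=
  \sum_s x s *: F s.

Lemma ext_lin_is_linear (V : lmodType R) (F : set_q -> V) : linear (ext_lin F).
Proof.
move=> c x y; rewrite /ext_lin scaler_sumr -big_split /=.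
by apply: eq_bigr => s _; rewrite !ffunE scalerDl -scalerA.
Qed.
HB.instance Definition _ (V : lmodType R) (F : set_q -> V) :=
  GRing.isLinear.Build R ext V *:%R (ext_lin F) (ext_lin_is_linear F).

Lemma ext_lin_bas (V : lmodType R) (F : set_q -> V) s : ext_lin F (ebas s) = F s.
Proof.
rewrite /ext_lin (bigD1 s) //= ebasE eqxx scale1r big1 ?addr0 // => t nts.
by rewrite ebasE (negbTE nts) scale0r.
Qed.

Lemma ext_linP (V : lmodType R) (f g : {linear ext -> V}) :
  (forall s, f (ebas s) = g (ebas s)) -> f =1 g.
Proof.
move=> fg x; rewrite [x]ext_expand !linear_sum; apply: eq_bigr => s _.
by rewrite !linearZ fg.
Qed.

(** The length of the permutation that sorts the increasing list of [s] followed by that of [t]; its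
    parity gives the sign in e_s e_t = ± e_(s ∪ t) for disjoint [s] and [t]. *)
Definition inversions (s t : set_q) : nat := \sum_(i in s) \sum_(j in t) (j < i)%N.

Definition rank_in (s : set_q) (j : 'I_q) : nat := #|[set l in s | (l < j)%N]|.

Definition shuffle_sign (s t : set_q) : R :=
  if [disjoint s & t] then (-1) ^+ inversions s t else 0.

Definition ext_mul (x y : ext) : ext :=
  ext_lin (fun s => ext_lin (fun t => shuffle_sign s t *: ebas (s :|: t)) y) x.

Definition ext_d : ext -> ext :=
  ext_lin (fun s => \sum_(j in s) (-1) ^+ rank_in s j *: ebas (s :\ j)).

(** The grade involution; it carries the sign of the Leibniz rule for elements that need not be
    homogeneous. *)
Definition ext_inv (x : ext) : ext := [ffun s : set_q => (-1) ^+ #|s| * x s].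

HB.instance Definition _ := GRing.Linear.on ext_d.

Lemma ext_inv_is_linear : linear ext_inv.
Proof.
move=> c x y; apply/ffunP => s; rewrite !ffunE mulrDr; congr (_ + _).
by rewrite /GRing.scale /= mulrCA.
Qed.
HB.instance Definition _ :=
  GRing.isLinear.Build R ext ext *:%R ext_inv ext_inv_is_linear.

Lemma ext_mul_is_linear x : linear (ext_mul x).
Proof.
move=> c y z; rewrite /ext_mul /ext_lin scaler_sumr -big_split /=.
apply: eq_bigr => s _; rewrite [\sum_t _](linearP (ext_lin _)).
by rewrite scalerDr !scalerA mulrC.
Qed.
HB.instance Definition _ x :=
  GRing.isLinear.Build R ext ext *:%R (ext_mul x) (ext_mul_is_linear x).

Lemma ext_mul_lin y : linear (ext_mul^~ y).
Proof. by move=> c x z; rewrite /ext_mul linearP. Qed.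

Lemma ext_mulDl x y z : ext_mul (x + y) z = ext_mul x z + ext_mul y z.
Proof. by rewrite /ext_mul linearD. Qed.
Lemma ext_mulBl x y z : ext_mul (x - y) z = ext_mul x z - ext_mul y z.
Proof. by rewrite /ext_mul linearB. Qed.
Lemma ext_mulZl c x z : ext_mul (c *: x) z = c *: ext_mul x z.
Proof. by rewrite /ext_mul linearZ. Qed.
Lemma ext_mul0l z : ext_mul 0 z = 0.
Proof. by rewrite /ext_mul linear0. Qed.

Lemma ext_mul_bas s t :
  ext_mul (ebas s) (ebas t) = shuffle_sign s t *: ebas (s :|: t).
Proof. by rewrite /ext_mul !ext_lin_bas. Qed.

Lemma ext_d_bas s :
  ext_d (ebas s) = \sum_(j in s) (-1) ^+ rank_in s j *: ebas (s :\ j).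
Proof. exact: ext_lin_bas. Qed.

Lemma ext_inv_bas s : ext_inv (ebas s) = (-1) ^+ #|s| *: ebas s.
Proof.
apply/ffunP => t; rewrite !ffunE; have [->//|_] := eqVneq t s.
by rewrite mulr0 scaler0.
Qed.

Lemma ext_invK : involutive ext_inv.
Proof. by move=> x; apply/ffunP => s; rewrite !ffunE signrMK. Qed.

(** * Signs of shuffles and associativity *)

Lemma sum_setU (s t : set_q) (F : 'I_q -> nat) : [disjoint s & t] ->
  (\sum_(i in s :|: t) F i = \sum_(i in s) F i + \sum_(i in t) F i)%N.
Proof. by move=> st; rewrite -bigU //; apply: eq_bigl => i; rewrite !inE. Qed.

Lemma inversionsUl (s t r : set_q) : [disjoint s & t] ->
  inversions (s :|: t) r = (inversions s r + inversions t r)%N.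
Proof. by move=> st; rewrite /inversions sum_setU. Qed.

Lemma inversionsUr (s t r : set_q) : [disjoint t & r] ->
  inversions s (t :|: r) = (inversions s t + inversions s r)%N.
Proof.
move=> tr; rewrite /inversions -big_split; apply: eq_bigr => i _.
by rewrite sum_setU.
Qed.

Lemma inversions_sym (s t : set_q) : [disjoint s & t] ->
  (inversions s t + inversions t s = #|s| * #|t|)%N.
Proof.
move=> st; rewrite /inversions [X in (_ + X)%N]exchange_big -big_split /=.
rewrite -sum_nat_const; apply: eq_bigr => i si; rewrite -big_split /= -sum1_card.
apply: eq_bigr => j tj; have : i != j :> nat.
  by apply: contraTneq tj => /val_inj <-; rewrite (disjointFr st).
by case: ltngtP.
Qed.

Lemma inversions1 i t : inversions [set i] t = rank_in t i.
Proof.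
rewrite /inversions big_set1 /rank_in -sum1dep_card big_mkcondr /=.
by apply: eq_bigr => j _; case: ltnP.
Qed.

Lemma disjointsUl (s t r : set_q) :
  [disjoint s :|: t & r] = [disjoint s & r] && [disjoint t & r].
Proof. by rewrite -!setI_eq0 setIUl setU_eq0. Qed.

Lemma disjointsUr (s t r : set_q) :
  [disjoint s & t :|: r] = [disjoint s & t] && [disjoint s & r].
Proof. by rewrite -!setI_eq0 setIUr setU_eq0. Qed.

(** When the three sets are pairwise disjoint, both exponents count the inversions between [s] and
    [t], [s] and [r], [t] and [r]; otherwise both sides vanish. *)
Lemma shuffle_signA s t r :
  shuffle_sign s t * shuffle_sign (s :|: t) r =
  shuffle_sign t r * shuffle_sign s (t :|: r).
Proof.
rewrite /shuffle_sign disjointsUl disjointsUr.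
case st: [disjoint s & t]; case tr: [disjoint t & r];
  case: [disjoint s & r]; rewrite ?mulr0 ?mul0r //=.
by rewrite -!exprD inversionsUl // inversionsUr // addnA addnC.
Qed.

Lemma ext_mulA x y z : ext_mul (ext_mul x y) z = ext_mul x (ext_mul y z).
Proof.
elim/ext_ind: x => [|x x' ? ?|c s]; first by rewrite !ext_mul0l.
  by rewrite !ext_mulDl; congr (_ + _).
rewrite !ext_mulZl; congr (_ *: _).
elim/ext_ind: y => [|y y' E E'|c' t]; first by rewrite linear0 !ext_mul0l linear0.
  by rewrite linearD !ext_mulDl linearD E E'.
rewrite linearZ !ext_mulZl linearZ; congr (_ *: _).
elim/ext_ind: z => [|z z' E E'|c'' r]; first by rewrite !linear0.
  by rewrite !linearD /= E E'.
rewrite !linearZ /=; congr (_ *: _).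
rewrite !ext_mul_bas linearZ /= !ext_mulZl !ext_mul_bas !scalerA setUA.
by rewrite shuffle_signA.
Qed.

Lemma ext_mul1l x : ext_mul (ebas set0) x = x.
Proof.
move: x; apply: (ext_linP (g := idfun)) => s /=; rewrite ext_mul_bas set0U.
by rewrite /shuffle_sign -setI_eq0 set0I eqxx /inversions big_set0 scale1r.
Qed.

Lemma ext_mul1r x : ext_mul x (ebas set0) = x.
Proof.
elim/ext_ind: x => [|x y E E'|c s]; first by rewrite ext_mul0l.
  by rewrite ext_mulDl E E'.
rewrite ext_mulZl ext_mul_bas setU0 /shuffle_sign -setI_eq0 setI0 eqxx.
by rewrite /inversions big1 ?scale1r // => i _; rewrite big_set0.
Qed.

(** * Homological degree and graded commutativity *)

Definition ext_deg (i : nat) (x : ext) : Prop := forall s, x s != 0 -> #|s| = i.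

Lemma shuffle_signC (s t : set_q) :
  shuffle_sign s t = (-1) ^+ (#|s| * #|t|) * shuffle_sign t s.
Proof.
rewrite /shuffle_sign [[disjoint t & s]]disjoint_sym.
case: ifP => [st|]; last by rewrite mulr0.
by rewrite -(inversions_sym st) exprD -mulrA -expr2 sqrr_sign mulr1.
Qed.

Lemma ext_mul_comm i j x y : ext_deg i x -> ext_deg j y ->
  ext_mul x y = (-1) ^+ (i * j) *: ext_mul y x.
Proof.
move=> dx dy.
apply: (@ext_ind_supp (fun x => ext_mul x y = _ *: ext_mul y x)) => [|x1 x2 E1 E2|s /dx <-].
- by rewrite ext_mul0l linear0 scaler0.
- by rewrite ext_mulDl linearD /= E1 E2 scalerDr.
apply: (@ext_ind_supp (fun y => ext_mul _ y = _ *: ext_mul y _)) => [|y1 y2 E1 E2|t /dy <-].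
- by rewrite ext_mul0l linear0 scaler0.
- by rewrite ext_mulDl linearD /= E1 E2 scalerDr.
rewrite !linearZ /= !ext_mulZl !linearZ /= !ext_mul_bas [t :|: s]setUC !scalerA.
by rewrite shuffle_signC; congr (_ *: _); ring.
Qed.

Lemma ext_mul_sqr0 i x : ext_deg i x -> odd i -> ext_mul x x = 0.
Proof.
move=> dx oi.
suff [] : ext_deg i x /\ ext_mul x x = 0 by [].
apply: (@ext_ind_supp (fun x => ext_deg i x /\ ext_mul x x = 0))
  => [|y z [dy y0] [dz z0]|s xs].
- by split=> [s|]; rewrite ?linear0 // ffunE eqxx.
- split=> [s|].
    by rewrite ffunE; have [->|/dy//] := eqVneq (y s) 0; rewrite add0r; apply: dz.
  rewrite ext_mulDl !linearD /= y0 z0 add0r addr0 (ext_mul_comm dy dz).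
  by rewrite -signr_odd oddM oi scaleN1r addNr.
split=> [t|].
  rewrite ext_scaleE ebasE; have [->|_] := eqVneq t s; first by move=> _; apply: dx.
  by rewrite mulr0 eqxx.
rewrite ext_mulZl linearZ /= ext_mul_bas /shuffle_sign -setI_eq0 setIid.
case: eqP => [s0|_]; last by rewrite scale0r !scaler0.
by move: (dx _ xs) oi; rewrite s0 cards0 => <-.
Qed.

(** * The contraction as a derivation of square zero *)

Lemma rank_inU (s t : set_q) j : [disjoint s & t] ->
  rank_in (s :|: t) j = (rank_in s j + rank_in t j)%N.
Proof. by move=> st; rewrite -!inversions1 inversionsUr. Qed.

Lemma rank_in1 i j : rank_in [set i] j = (i < j)%N.
Proof. by rewrite -inversions1 /inversions !big_set1. Qed.

Lemma rank_inU1 i (s : set_q) j : i \notin s -> rank_in (i |: s) j = ((i < j) + rank_in s j)%N.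
Proof. by move=> si; rewrite rank_inU ?disjoints1 // rank_in1. Qed.

Lemma rank_inD1 i (s : set_q) j : i \in s -> rank_in s j = ((i < j) + rank_in (s :\ i) j)%N.
Proof. by move=> si; rewrite -{1}(setD1K si) rank_inU1 ?setD11. Qed.

Lemma shuffle_sign1 i t :
  shuffle_sign [set i] t = if i \in t then 0 else (-1) ^+ rank_in t i.
Proof. by rewrite /shuffle_sign disjoints1 inversions1 if_neg. Qed.

(** Multiplication by e_i is a homotopy from the identity to zero. All exactness statements and the
    retraction below rest on this identity. *)
Lemma ext_d_mul1 i y :
  ext_d (ext_mul (ebas [set i]) y) = y - ext_mul (ebas [set i]) (ext_d y).
Proof.
apply/eqP; rewrite eq_sym subr_eq eq_sym; apply/eqP.
elim/ext_ind: y => [|y z E E'|c t]; first by rewrite !linear0 addr0.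
  by rewrite !linearD -{3}E -{3}E' addrACA.
rewrite !linearZ /= -scalerDr; congr (_ *: _).
rewrite ext_mul_bas linearZ /= !ext_d_bas [ext_mul _ (\sum_(j in t) _)]linear_sum.
rewrite shuffle_sign1 /=.
(* If [i] lies in [t], then e_i e_t = 0 and only the term j = i of d e_t survives multiplication by
   e_i. If not, the term j = i of d (e_i e_t) is e_t and the other terms cancel in pairs. *)
have [it|it] := boolP (i \in t).
  rewrite scale0r add0r (bigD1 i) //= linearZ /= ext_mul_bas shuffle_sign1 setD11.
  rewrite !scalerA (rank_inD1 i it) ltnn -expr2 sqrr_sign scale1r setD1K //.
  rewrite big1 ?addr0 // => j /andP[_ ji].
  rewrite linearZ /= ext_mul_bas shuffle_sign1 !inE it eq_sym ji /= scale0r scaler0 //.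
rewrite big_setU1 //= scalerDr rank_inU1 // ltnn scalerA -expr2 sqrr_sign scale1r.
rewrite setU1K // -addrA scaler_sumr -big_split big1 /= ?addr0 // => j tj.
have ij : i != j by apply: contraNneq it => ->.
have ji : i \notin t :\ j by rewrite !inE (negbTE it) andbF.
rewrite [ext_mul _ (_ *: _)]linearZ /= ext_mul_bas shuffle_sign1 (negbTE ji).
have -> : (i |: t) :\ j = i |: (t :\ j).
  by apply/setP => l; rewrite !inE; have [->|] := eqVneq l i; rewrite ?ij.
(* Exactly one of [i < j] and [j < i] adds 1 to the first exponent, so the two signs are
   opposite. *)
rewrite !scalerA -scalerDl -!exprD (rank_inU1 _ it) [rank_in t i](rank_inD1 _ tj).
have : i != j :> nat by apply: contraNneq ij => /val_inj ->.
case: ltngtP => // _ _; rewrite -[RHS](scale0r (ebas (i |: t :\ j)));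
  by congr (_ *: _); rewrite !exprD; ring.
Qed.

Lemma ebas_setD1 i (s : set_q) : i \in s ->
  ebas s = (-1) ^+ rank_in (s :\ i) i *: ext_mul (ebas [set i]) (ebas (s :\ i)).
Proof.
move=> si; rewrite ext_mul_bas shuffle_sign1 setD11 scalerA -expr2 sqrr_sign.
by rewrite scale1r setD1K.
Qed.

Lemma ext_d_set0 : ext_d (ebas set0) = 0.
Proof. by rewrite ext_d_bas big_set0. Qed.

(** Induction on the size of a basis set: applying [ext_d_mul1] twice gives d d (e_i y) = e_i d d
    y. *)
Lemma ext_dd x : ext_d (ext_d x) = 0.
Proof.
elim/ext_ind: x => [|x y E E'|c s]; first by rewrite !linear0.
  by rewrite !linearD /= E E' addr0.
rewrite !linearZ /=; suff -> : ext_d (ext_d (ebas s)) = 0 by rewrite scaler0.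
have [N] := ubnP #|s|; elim: N s => // N IH s sN.
have [->|[i si]] := set_0Vmem s; first by rewrite ext_d_set0 linear0.
rewrite (ebas_setD1 si) !linearZ /= ext_d_mul1 linearB /= ext_d_mul1 opprB.
have sD : (#|s :\ i| < N)%N by rewrite (cardsD1 i) si in sN.
by rewrite IH // linear0 sub0r subrr scaler0.
Qed.

(** Peel one generator e_i off the left factor, use [ext_d_mul1] on both e_i z and e_i (z y), and
    conclude by induction on the size of the basis set. *)
Lemma ext_leibniz x y :
  ext_d (ext_mul x y) = ext_mul (ext_d x) y + ext_mul (ext_inv x) (ext_d y).
Proof.
elim/ext_ind: x => [|x z E E'|c s]; first by rewrite !(linear0, ext_mul0l) addr0.
  by rewrite !(linearD, ext_mulDl) /= E E' addrACA.
rewrite ext_mulZl !linearZ /= !ext_mulZl -scalerDr; congr (_ *: _).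
have [N] := ubnP #|s|; elim: N s y => // N IH s y sN.
have [->|[i si]] := set_0Vmem s.
  by rewrite ext_d_set0 ext_inv_bas cards0 scale1r !ext_mul1l ext_mul0l add0r.
have sD : (#|s :\ i| < N)%N by rewrite (cardsD1 i) si in sN.
rewrite ext_inv_bas (cardsD1 i) si (ebas_setD1 si) ext_mulZl !linearZ /= !ext_mulZl.
rewrite -scalerDr; congr (_ *: _).
rewrite !ext_mulA !ext_d_mul1 ext_mulBl ext_mulA IH // linearD /= ext_inv_bas.
by rewrite ext_mulZl linearZ /= add1n exprS mulN1r scaleNr opprD addrA.
Qed.

Lemma ext_inv_deg i x : ext_deg i x -> ext_inv x = (-1) ^+ i *: x.
Proof.
move=> dx; apply/ffunP => s; rewrite !ffunE.
by have [->|/dx->//] := eqVneq (x s) 0; rewrite mulr0 scaler0.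
Qed.

(** * Coefficients, and conditions on them that the operations preserve *)

Lemma ext_mul1E i (x : ext) t : ext_mul (ebas [set i]) x t =
  if i \in t then (-1) ^+ rank_in (t :\ i) i * x (t :\ i) else 0.
Proof.
rewrite /ext_mul ext_lin_bas /ext_lin ext_sumE.
case: ifP => it; last first.
  apply: big1 => s _; rewrite !ext_scaleE ebasE.
  by case: eqP => [ts|_]; rewrite ?mulr0 //; move: it; rewrite ts setU11.
rewrite (bigD1 (t :\ i)) //= setD1K // !ext_scaleE ebasE eqxx mulr1.
rewrite shuffle_sign1 setD11 mulrC big1 ?addr0 // => s sti.
rewrite !ext_scaleE ebasE shuffle_sign1; case: ifP => is_; first by rewrite !(mulr0, mul0r).
case: eqP => [ts|_]; last by rewrite !mulr0.
by move: sti; rewrite ts setU1K ?is_ ?eqxx.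
Qed.

Lemma ext_dE (x : ext) t :
  ext_d x t = \sum_(j | j \notin t) (-1) ^+ rank_in t j * x (j |: t).
Proof.
rewrite /ext_d /ext_lin ext_sumE.
under eq_bigr => s _.
  rewrite ext_scaleE ext_sumE mulr_sumr.
  under eq_bigr => j _ do rewrite ext_scaleE ebasE.
  over.
rewrite (exchange_big_dep xpredT) //= [RHS]big_mkcond; apply: eq_bigr => j _.
case: ifPn => [jt|/negPn jt].
  rewrite (bigD1 (j |: t)) /= ?setU11 // setU1K // eqxx mulr1.
  rewrite rank_inU1 // ltnn mulrC big1 ?addr0 // => s /andP[js /eqP st].
  case: eqP => [ts|_]; last by rewrite !mulr0.
  by case: st; rewrite ts setD1K.
apply: big1 => s js; case: eqP => [ts|_]; last by rewrite !mulr0.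
by move: jt; rewrite ts setD11.
Qed.

Lemma ext_d_neq0 (x : ext) t : ext_d x t != 0 -> exists2 j, j \notin t & x (j |: t) != 0.
Proof.
move=> dxt; case: (pickP (fun j => (j \notin t) && (x (j |: t) != 0))) => [j /andP[]|none].
  by exists j.
case/eqP: dxt; rewrite ext_dE big1 // => j jt.
by have := none j; rewrite jt /= => /eqP->; rewrite mulr0.
Qed.

Lemma ext_mul1_neq0 i (x : ext) t :
  ext_mul (ebas [set i]) x t != 0 -> i \in t /\ x (t :\ i) != 0.
Proof.
rewrite ext_mul1E; case: ifP => [it|_]; last by rewrite eqxx.
by move=> xt; split=> //; apply: contra_neq xt => ->; rewrite mulr0.
Qed.

(** One additive subgroup of [R] for each subset. Degree, support, divisibility by lcms, ideal
    membership and the vanishing of a single coefficient all have this shape, so the transfer lemmas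
    below serve them all. *)
Record graded_subgroups (C : set_q -> R -> Prop) : Prop := GradedSubgroups {
  graded_sub0 : forall t, C t 0;
  graded_subD : forall t a b, C t a -> C t b -> C t (a + b);
  graded_subN : forall t a, C t a -> C t (- a) }.

Lemma graded_sub_sign C t n a : graded_subgroups C -> C t a -> C t ((-1) ^+ n * a).
Proof.
move=> CC Ca; elim: n => [|n IH]; first by rewrite mul1r.
by rewrite exprS -mulrA mulN1r; apply: graded_subN.
Qed.

Lemma graded_sub_sum C t (I : Type) (r : seq I) (P : pred I) (F : I -> R) :
  graded_subgroups C -> (forall i, P i -> C t (F i)) ->
  C t (\sum_(i <- r | P i) F i).
Proof.
by move=> CC CF; elim/big_ind: _ => //; [apply: graded_sub0|move=> ? ?; apply: graded_subD].
Qed.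

Lemma ext_mul_sub C (x y : ext) : graded_subgroups C ->
  (forall s r : set_q, [disjoint s & r] -> x s != 0 -> y r != 0 -> C (s :|: r) (x s * y r)) ->
  forall t, C t (ext_mul x y t).
Proof.
move=> CC Cxy t; rewrite /ext_mul /ext_lin ext_sumE; apply: graded_sub_sum => // s _.
rewrite ext_scaleE ext_sumE mulr_sumr; apply: graded_sub_sum => // r _.
rewrite !ext_scaleE ebasE /shuffle_sign.
case: ifP => [sr|_]; last by rewrite !(mul0r, mulr0); apply: graded_sub0.
case: eqP => [->|_]; last by rewrite !mulr0; apply: graded_sub0.
rewrite mulr1 mulrCA mulrA mulrC mulrA mulrAC.
have [->|xs] := eqVneq (x s) 0; first by rewrite mulr0 mul0r; apply: graded_sub0.
have [->|yr] := eqVneq (y r) 0; first by rewrite mulr0; apply: graded_sub0.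
by rewrite -mulrA; apply: graded_sub_sign => //; apply: Cxy.
Qed.

Lemma ext_d_sub C (x : ext) : graded_subgroups C ->
  (forall (t : set_q) j, j \notin t -> x (j |: t) != 0 -> C t (x (j |: t))) ->
  forall t, C t (ext_d x t).
Proof.
move=> CC Cx t; rewrite ext_dE; apply: graded_sub_sum => // j jt.
apply: graded_sub_sign => //.
by have [->|/Cx//] := eqVneq (x (j |: t)) 0; [apply: graded_sub0|apply].
Qed.

Lemma ext_mul1_sub C i (x : ext) : graded_subgroups C ->
  (forall t : set_q, i \in t -> x (t :\ i) != 0 -> C t (x (t :\ i))) ->
  forall t, C t (ext_mul (ebas [set i]) x t).
Proof.
move=> CC Cx t; rewrite ext_mul1E; case: ifP => [it|_]; last exact: graded_sub0.
apply: graded_sub_sign => //.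
by have [->|/Cx//] := eqVneq (x (t :\ i)) 0; [apply: graded_sub0|apply].
Qed.

Definition supported (P : set_q -> Prop) (x : ext) : Prop := forall s, x s != 0 -> P s.

(** A support condition is the family that is all of [R] at [t] when [P t] holds and zero
    otherwise. *)
Lemma graded_supported P : graded_subgroups (fun t (a : R) => a != 0 -> P t).
Proof.
split=> [t|t a b Pa Pb|t a]; rewrite ?eqxx ?oppr_eq0 //.
by have [->|/Pa] := eqVneq a 0; rewrite ?add0r.
Qed.

Lemma supportedD P x y : supported P x -> supported P y -> supported P (x + y).
Proof.
by move=> Px Py s; rewrite ffunE; exact: (graded_subD (graded_supported P) (Px s) (Py s)).
Qed.

Lemma supportedB P x y : supported P x -> supported P y -> supported P (x - y).
Proof.
move=> Px Py; apply: supportedD => // s; rewrite ffunE.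
exact: (graded_subN (graded_supported P) (Py s)).
Qed.

Lemma ext_deg_mul i j x y : ext_deg i x -> ext_deg j y -> ext_deg (i + j) (ext_mul x y).
Proof.
move=> dx dy; apply: (ext_mul_sub (graded_supported _)) => s r sr /dx <- /dy <- _.
by have [_] := leq_card_setU s r; rewrite sr => /eqP.
Qed.

Lemma ext_deg_d i x : ext_deg i.+1 x -> ext_deg i (ext_d x).
Proof.
move=> dx; apply: (ext_d_sub (graded_supported _)) => t j jt /dx + _.
by rewrite cardsU1 jt => -[].
Qed.

Lemma ext_deg_d0 x : ext_deg 0 x -> ext_d x = 0.
Proof.
move=> dx; apply/ffunP => s; rewrite [RHS]ffunE; apply/eqP/negPn/negP.
by case/ext_d_neq0 => j js /dx; rewrite cardsU1 js.
Qed.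

Lemma ext_deg_mul1 v i x : ext_deg i x -> ext_deg i.+1 (ext_mul (ebas [set v]) x).
Proof.
move=> dx; apply: (ext_mul1_sub (graded_supported _)) => t vt /dx <- _.
by rewrite (cardsD1 v) vt.
Qed.

(** * Contracting homotopies from a splitting of the coefficients *)

Section SplitHomotopy.

Variable p : 'I_q -> {additive R -> R}.

(** The maps are only additive because selecting monomials is not linear over the polynomial ring.
    They still commute with [ext_d], whose matrix entries are signs or zero. *)
Definition ext_map (f : {additive R -> R}) (x : ext) : ext := [ffun t => f (x t)].

Lemma ext_d_map f x : ext_d (ext_map f x) = ext_map f (ext_d x).
Proof.
apply/ffunP => t; rewrite [RHS]ffunE !ext_dE raddf_sum; apply: eq_bigr => j _.
by rewrite ffunE raddfMsign.
Qed.

(** Each piece of a cycle is again a cycle, hence is the boundary of its product with e_v. If the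
    pieces add up to [x], this is a preimage of [x]. *)
Definition split_homotopy (x : ext) : ext :=
  \sum_v ext_mul (ebas [set v]) (ext_map (p v) x).

Lemma ext_d_split_homotopy x : ext_d x = 0 ->
  ext_d (split_homotopy x) = \sum_v ext_map (p v) x.
Proof.
move=> dx; rewrite linear_sum; apply: eq_bigr => v _.
rewrite /= ext_d_mul1 ext_d_map dx.
suff -> : ext_map (p v) 0 = 0 by rewrite linear0 subr0.
by apply/ffunP => t; rewrite !ffunE raddf0.
Qed.

Lemma split_homotopy_sub C (x : ext) : graded_subgroups C ->
  (forall v (t : set_q), v \in t -> C t (p v (x (t :\ v)))) ->
  forall t, C t (split_homotopy x t).
Proof.
move=> CC Cp t; rewrite ext_sumE; apply: (graded_sub_sum _ CC) => v _.
by apply: (ext_mul1_sub CC) => s vs _; rewrite ffunE; apply: Cp.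
Qed.

Lemma split_homotopy_deg i x : ext_deg i x -> ext_deg i.+1 (split_homotopy x).
Proof.
move=> dx; apply: (split_homotopy_sub (graded_supported _)) => v t vt pxt.
rewrite (cardsD1 v) vt dx //; apply: contra_neq pxt => ->; exact: raddf0.
Qed.

End SplitHomotopy.

(** * The retraction onto a pivot complex *)

Section PivotRetraction.

Variables (S : set_q) (v : 'I_q).
Hypothesis vS : v \notin S.

Definition above_part (x : ext) : ext :=
  [ffun s : set_q => if S \subset s then x s else 0].

Lemma above_part_is_linear : linear above_part.
Proof.
move=> c x y; apply/ffunP => s; rewrite !ffunE.
by case: ifP => _ //; rewrite scaler0 addr0.
Qed.
HB.instance Definition _ :=
  GRing.isLinear.Build R ext ext *:%R above_part above_part_is_linear.

Lemma above_part_neq0 x s : above_part x s != 0 -> S \subset s /\ x s != 0.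
Proof. by rewrite ffunE; case: ifP => // _; rewrite eqxx. Qed.

Definition pivot_cone (x : ext) : ext := ext_mul (ebas [set v]) (above_part x).

Lemma pivot_cone_is_linear : linear pivot_cone.
Proof. by move=> c x y; rewrite /pivot_cone !linearP. Qed.
HB.instance Definition _ :=
  GRing.isLinear.Build R ext ext *:%R pivot_cone pivot_cone_is_linear.

(** This is 1 - (d h + h d) with h = [pivot_cone], hence a chain map homotopic to the identity. *)
Definition retract (x : ext) : ext := x - (ext_d (pivot_cone x) + pivot_cone (ext_d x)).

Lemma retract_is_linear : linear retract.
Proof.
move=> c x y; rewrite /retract !linearP /= [X in _ - X]addrACA -scalerDr.
by rewrite opprD addrACA -scalerBr.
Qed.
HB.instance Definition _ :=
  GRing.isLinear.Build R ext ext *:%R retract retract_is_linear.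

Lemma retract_d x : ext_d (retract x) = retract (ext_d x).
Proof.
by rewrite /retract linearB linearD /= !ext_dd linear0 add0r addr0.
Qed.

Local Notation star := (supported (fun s => v |: S \subset s)).

Lemma pivot_cone_star x : star (pivot_cone x).
Proof.
move=> t /ext_mul1_neq0[vt /above_part_neq0[St _]].
rewrite subUset sub1set vt (subset_trans St) //; exact: subsetDl.
Qed.

Lemma star_mull x y : star x -> star (ext_mul x y).
Proof.
move=> Kx; apply: (ext_mul_sub (graded_supported _)) => s r _ /Kx Ks _ _.
exact: subset_trans Ks (subsetUl _ _).
Qed.

Lemma star_mulr x y : star y -> star (ext_mul x y).
Proof.
move=> Ky; apply: (ext_mul_sub (graded_supported _)) => s r _ _ /Ky Kr _.
exact: subset_trans Kr (subsetUr _ _).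
Qed.

Lemma star_inv x : star x -> star (ext_inv x).
Proof.
move=> Kx s; rewrite ffunE => xs; apply: Kx; apply: contra_neq xs => ->.
exact: mulr0.
Qed.

Lemma ext_mul1_eq0 i x : supported (fun s => i \in s) x -> ext_mul (ebas [set i]) x = 0.
Proof.
move=> ix; apply/ffunP => t; rewrite [RHS]ffunE; apply/eqP/negPn/negP.
by case/ext_mul1_neq0 => _ /ix; rewrite setD11.
Qed.

(** Here e_v x = 0, so h x = 0 and e_v (d x) = x; thus [retract x] is e_v times the part of d x not
    above [S]. That part arises by deleting an element of [S], so all its sets still contain [v],
    and e_v kills it. *)
Lemma retract_star x : star x -> retract x = 0.
Proof.
move=> Kx; have vx : supported (fun s => v \in s) x.
  by move=> s /Kx; rewrite subUset sub1set => /andP[].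
have -> : retract x = ext_mul (ebas [set v]) (ext_d x - above_part (ext_d x)).
  rewrite /retract /pivot_cone linearB /=.
  have -> : ext_mul (ebas [set v]) (above_part x) = 0.
    by apply: ext_mul1_eq0 => s /above_part_neq0[_ /vx].
  have /eqP := ext_d_mul1 v x; rewrite ext_mul1_eq0 // linear0 eq_sym subr_eq0 => /eqP <-.
  by rewrite add0r.
apply: ext_mul1_eq0 => t; rewrite !ffunE.
case: ifP => [_|/negbT St]; first by rewrite subrr eqxx.
rewrite subr0 => /ext_d_neq0[j jt /Kx]; rewrite subUset sub1set => /andP[+ Sj].
rewrite !inE => /orP[/eqP vj|//].
case/negP: St; apply/subsetP => l lS; move/subsetP: Sj => /(_ l lS).
by rewrite !inE -vj => /orP[/eqP lv|//]; move: vS; rewrite -lv lS.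
Qed.

(** Sets not containing [S] are closed under taking subsets, so neither [x] nor d x has a part above
    [S] and both cones vanish. *)
Lemma retract_id x : supported (fun s => ~~ (S \subset s)) x -> retract x = x.
Proof.
move=> Ox; have cone0 y : supported (fun s => ~~ (S \subset s)) y -> pivot_cone y = 0.
  move=> Oy; rewrite /pivot_cone; have -> : above_part y = 0; last by rewrite linear0.
  apply/ffunP => s; rewrite !ffunE; case: ifP => // Ss.
  by apply/eqP/negPn/negP => /Oy; rewrite Ss.
rewrite /retract !cone0 ?linear0 ?addr0 ?subr0 // => s /ext_d_neq0[j _ /Ox].
by apply: contra => /subset_trans-> //; apply: subsetUr.
Qed.

(** Only the part z above [S] matters. By [ext_d_mul1] its retraction is e_v times the part of d z
    not above [S], and adding [v], which is outside [S], cannot complete a set to one containing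
    [S]. *)
Lemma retract_supported x : supported (fun s => ~~ (S \subset s)) (retract x).
Proof.
have [y [z [-> Oy Sz]]] : exists y z, [/\ x = y + z, supported (fun s => ~~ (S \subset s)) y
    & z = above_part z].
  exists (x - above_part x), (above_part x); split; first by rewrite subrK.
    by move=> s; rewrite !ffunE; case: ifP => // _; rewrite subrr eqxx.
  by apply/ffunP => s; rewrite !ffunE; case: ifP.
rewrite linearD /= retract_id //; apply: supportedD => //.
have -> : retract z = ext_mul (ebas [set v]) (ext_d z - above_part (ext_d z)).
  rewrite /retract /pivot_cone -Sz ext_d_mul1 linearB /= opprD opprB addrA.
  by rewrite [z + _]addrC subrK.
move=> t /ext_mul1_neq0[_]; rewrite !ffunE; case: ifP => [_|/negbT St _].
  by rewrite subrr eqxx.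
apply: contra St => St; apply/subsetP => l lS; rewrite !inE (subsetP St) // andbT.
by apply: contraNneq vS => <-.
Qed.

Lemma retract_boundary_star k k' : star k -> star k' -> retract (ext_d k + k') = 0.
Proof.
by move=> Kk Kk'; rewrite linearD /= -retract_d !retract_star // linear0 addr0.
Qed.

(* [x - retract x] lies in [star + d star], which is a DG ideal killed by [retract]. *)
Lemma retract_mull x y : retract (ext_mul (retract x) y) = retract (ext_mul x y).
Proof.
rewrite {2}/retract ext_mulBl linearB /= ext_mulDl.
set k := pivot_cone x; set k' := pivot_cone _.
have -> : ext_mul (ext_d k) y = ext_d (ext_mul k y) - ext_mul (ext_inv k) (ext_d y).
  by rewrite ext_leibniz addrK.
rewrite -[X in _ - retract X]addrA retract_boundary_star ?subr0 //;
  first exact/star_mull/pivot_cone_star.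
rewrite addrC; apply: supportedB; apply: star_mull; last apply: star_inv;
  exact: pivot_cone_star.
Qed.

(** As for the left factor, with [ext_inv x] in place of [x] so that the Leibniz rule produces x (d
    k) without a sign. *)
Lemma retract_mulr x y : retract (ext_mul x (retract y)) = retract (ext_mul x y).
Proof.
rewrite {2}/retract [ext_mul x _]linearB /= [ext_mul x (_ + _)]linearD [LHS]linearB /=.
set k := pivot_cone y; set k' := pivot_cone _.
have -> : ext_mul x (ext_d k) = ext_d (ext_mul (ext_inv x) k) - ext_mul (ext_d (ext_inv x)) k.
  by rewrite ext_leibniz ext_invK addrC addKr.
rewrite -[X in _ - retract X]addrA retract_boundary_star ?subr0 //;
  first exact/star_mulr/pivot_cone_star.
by rewrite addrC; apply: supportedB; apply: star_mulr; apply: pivot_cone_star.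
Qed.

Lemma pivot_cone_deg i x : ext_deg i x -> ext_deg i.+1 (pivot_cone x).
Proof. by move=> dx; apply: ext_deg_mul1 => s /above_part_neq0[_ /dx]. Qed.

Lemma retract_deg i x : ext_deg i x -> ext_deg i (retract x).
Proof.
move=> dx; apply: supportedB => //; apply: supportedD.
  exact/ext_deg_d/pivot_cone_deg.
case: i dx => [|i] dx; first by rewrite ext_deg_d0 // linear0 => s; rewrite ffunE eqxx.
exact/pivot_cone_deg/ext_deg_d.
Qed.

(** The second closure condition is where m_v dividing lcm S enters: adding [v] to a set above [S]
    then leaves the lcm unchanged. *)
Lemma retract_sub C (x : ext) : graded_subgroups C ->
  (forall (s t : set_q) a, s \subset t -> C t a -> C s a) ->
  (forall (s : set_q) a, S \subset s -> C s a -> C (v |: s) a) ->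
  (forall s, C s (x s)) -> forall s, C s (retract x s).
Proof.
move=> CC Canti Cv Cx.
have Cd (y : ext) : (forall s, C s (y s)) -> forall s, C s (ext_d y s).
  by move=> Cy; apply: (ext_d_sub CC) => t j _ _; apply: Canti (Cy _); apply: subsetUr.
have Ccone (y : ext) : (forall s, C s (y s)) -> forall s, C s (pivot_cone y s).
  move=> Cy; apply: (ext_mul1_sub CC) => t vt /above_part_neq0[St _].
  by rewrite ffunE St -{1}(setD1K vt); apply: Cv.
move=> s; rewrite !ffunE.
apply: (graded_subD CC (Cx s)); apply: (graded_subN CC); apply: (graded_subD CC).
  exact/Cd/Ccone.
exact/Ccone/Cd.
Qed.

End PivotRetraction.

End ExteriorAlgebra.

(** * Monomials *)

Section Monomials.

Variables (k : fieldType) (n : nat).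
Local Notation Q := {mpoly k[n]}.

Definition mono_ge (u : 'X_{1..n}) (f : Q) : Prop :=
  forall w, f@_w != 0 -> (u <= w)%MM.

Lemma mono_ge0 u : mono_ge u 0.
Proof. by move=> w; rewrite mcoeff0 eqxx. Qed.

Lemma mono_geD u f g : mono_ge u f -> mono_ge u g -> mono_ge u (f + g).
Proof.
move=> fu gu w; rewrite mcoeffD.
by have [->|/fu//] := eqVneq f@_w 0; rewrite add0r; apply: gu.
Qed.

Lemma mono_geN u f : mono_ge u f -> mono_ge u (- f).
Proof. by move=> fu w; rewrite mcoeffN oppr_eq0; apply: fu. Qed.

Lemma mono_geM u v f g : mono_ge u f -> mono_ge v g -> mono_ge (u + v) (f * g).
Proof.
move=> fu gv w; rewrite -mcoeff_msupp => /msuppM_le /allpairsP[[a b] /= [af bg ->]].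
apply/mnm_lepP => i; rewrite !mnmDE leq_add //; apply/mnm_lepP.
  by apply: fu; rewrite -mcoeff_msupp.
by apply: gv; rewrite -mcoeff_msupp.
Qed.

Lemma mono_geX u : mono_ge u 'X_[u].
Proof. by move=> w; rewrite mcoeffX; have [->|_] := eqVneq u w; rewrite ?lepm_refl ?eqxx. Qed.

Lemma mono_geW u v f : (v <= u)%MM -> mono_ge u f -> mono_ge v f.
Proof. by move=> vu fu w /fu; apply: lepm_trans. Qed.

(* [w - u] is truncated, but only exact quotients occur when [mono_ge u f]. *)
Definition mono_div (u : 'X_{1..n}) (f : Q) : Q :=
  \sum_(w <- msupp f) f@_w *: 'X_[(w - u)%MM].

Lemma mono_divK u f : mono_ge u f -> mono_div u f * 'X_[u] = f.
Proof.
move=> fu; rewrite [RHS]mpolyE /mono_div mulr_suml; apply: eq_big_seq => w.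
by rewrite mcoeff_msupp => /fu uw; rewrite -scalerAl -mpolyXD submK.
Qed.

Definition mono_filter (P : pred 'X_{1..n}) (f : Q) : Q :=
  \sum_(w <- msupp f | P w) f@_w *: 'X_[w].

Lemma mcoeff_mono_filter P f u : (mono_filter P f)@_u = if P u then f@_u else 0.
Proof.
rewrite /mono_filter raddf_sum /=.
under eq_bigr => w _ do rewrite mcoeffZ mcoeffX.
have [uf|uf] := boolP (u \in msupp f).
  rewrite big_mkcond (bigD1_seq u) //= ?msupp_uniq // eqxx mulr1 big1 ?addr0 // => w wu.
  by case: ifP; rewrite // (negbTE wu) mulr0.
rewrite memN_msupp_eq0 // if_same big_seq_cond big1 // => w /andP[wf _].
by case: eqP => [wu|_]; rewrite ?mulr0 //; rewrite wu (negbTE uf) in wf.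
Qed.

Lemma mono_filter_is_zmod_morphism P : zmod_morphism (mono_filter P).
Proof.
move=> f g; apply/mpolyP => u; rewrite mcoeffB !mcoeff_mono_filter mcoeffB.
by case: ifP => _ //; rewrite subr0.
Qed.
HB.instance Definition _ P :=
  GRing.isZmodMorphism.Build Q Q (mono_filter P) (mono_filter_is_zmod_morphism P).

(** For the converse, choose an element of [S] below each monomial of [f]; the sum then has one
    summand per monomial of [f]. *)
Lemma monomial_spanP (S : 'X_{1..n} -> Prop) (f : Q) :
  monomial_span S f <-> forall u, f@_u != 0 -> exists2 s, S s & (s <= u)%MM.
Proof.
split=> [[r [g [s [Ss ->]]]] u|fS].
  rewrite raddf_sum /= => fu.
  case: (pickP (fun j => (g j * 'X_[s j])@_u != 0)) => [j gu|g0]; last first.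
    by case/eqP: fu; apply: big1 => j _; apply/eqP/negPn; rewrite g0.
  have g_ge0 : mono_ge 0 (g j) by move=> w _; apply/mnm_lepP => i; rewrite mnm0E.
  exists (s j) => //.
  by have := mono_geM g_ge0 (@mono_geX (s j)) gu; rewrite add0m.
pose u (j : 'I_(size (msupp f))) := nth 0%MM (msupp f) j.
have /fin_all_exists[s Ps] j : exists s, S s /\ (s <= u j)%MM.
  by have [|s] := fS (u j); [rewrite -mcoeff_msupp mem_nth|exists s].
exists (size (msupp f)), (fun j => f@_(u j) *: 'X_[(u j - s j)%MM]), s.
split=> [j|]; first by case: (Ps j).
rewrite [LHS]mpolyE (big_nth 0%MM) big_mkord; apply: eq_bigr => j _.
by rewrite -scalerAl -mpolyXD submK //; case: (Ps j).
Qed.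

End Monomials.

(** * Least common multiples over sets of generators *)

Section LcmSet.

Variables (n q : nat) (m : 'I_q -> 'X_{1..n}).

Lemma mlcm_setP (A : {set 'I_q}) u :
  reflect (forall i, i \in A -> (m i <= u)%MM) (mlcm_set m A <= u)%MM.
Proof.
have -> : (mlcm_set m A <= u)%MM =
    all (fun i => (i \in A) ==> (m i <= u)%MM) (index_enum 'I_q).
  rewrite /mlcm_set; elim: (index_enum _) => [|i r IH] /=.
    by rewrite big_nil; apply/mnm_lepP => i; rewrite mnm0E.
  by rewrite big_cons -IH; case: ifP => //= _; rewrite lem_mlcm.
apply: (iffP allP) => [h i iA|h i _]; last exact/implyP/h.
exact: (implyP (h i (mem_index_enum i))).
Qed.

Lemma lem_mlcm_set (A : {set 'I_q}) i : i \in A -> (m i <= mlcm_set m A)%MM.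
Proof. by move: i; apply/mlcm_setP/lepm_refl. Qed.

Lemma mlcm_setS (A B : {set 'I_q}) : A \subset B -> (mlcm_set m A <= mlcm_set m B)%MM.
Proof. by move=> /subsetP AB; apply/mlcm_setP => i /AB; apply: lem_mlcm_set. Qed.

Lemma mlcm_setU_le (A B : {set 'I_q}) :
  (mlcm_set m (A :|: B) <= mlcm_set m A + mlcm_set m B)%MM.
Proof.
apply/mlcm_setP => i; rewrite inE => /orP[] /lem_mlcm_set /lepm_trans; apply.
  exact: lem_addr.
exact: lem_addl.
Qed.

Lemma mlcm_set0 : mlcm_set m set0 = 0%MM.
Proof. by rewrite /mlcm_set big_set0. Qed.

End LcmSet.

(** * Embedding Taylor subcomplexes *)

Section Embedding.

Variables (k : fieldType) (n q : nat) (m : 'I_q -> 'X_{1..n}).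
Local Notation Q := {mpoly k[n]}.
Local Notation lcm := (mlcm_set m).

Definition lcm_divisible (x : ext Q q) : Prop := forall t, mono_ge (lcm t) (x t).

Lemma graded_mono_ge : graded_subgroups (fun t (f : Q) => mono_ge (lcm t) f).
Proof. by split=> [t|t a b|t a]; [apply: mono_ge0|apply: mono_geD|apply: mono_geN]. Qed.

Lemma lcm_divisibleB x y :
  lcm_divisible x -> lcm_divisible y -> lcm_divisible (x - y).
Proof. by move=> Cx Cy t; rewrite !ffunE; apply/mono_geD/mono_geN. Qed.

Lemma lcm_divisible_mul x y :
  lcm_divisible x -> lcm_divisible y -> lcm_divisible (ext_mul x y).
Proof.
move=> Cx Cy; apply: (ext_mul_sub graded_mono_ge) => s r _ _ _.
by apply: mono_geW (mono_geM (Cx s) (Cy r)); apply: mlcm_setU_le.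
Qed.

Lemma lcm_divisible_d x : lcm_divisible x -> lcm_divisible (ext_d x).
Proof.
move=> Cx; apply: (ext_d_sub graded_mono_ge) => t j _ _.
by apply: mono_geW (Cx _); apply/mlcm_setS/subsetUr.
Qed.

Lemma lcm_divisible_retract (S : {set 'I_q}) v x : (m v <= lcm S)%MM ->
  lcm_divisible x -> lcm_divisible (retract S v x).
Proof.
move=> vS Cx; apply: (retract_sub graded_mono_ge) => // [s t a st|s a Ss].
  exact/mono_geW/mlcm_setS.
apply: mono_geW; apply/mlcm_setP => i; rewrite !inE => /orP[/eqP->|/lem_mlcm_set//].
exact: lepm_trans vS (mlcm_setS m Ss).
Qed.

Lemma lcm_divisible1 : lcm_divisible (ebas Q set0).
Proof.
move=> t; rewrite ebasE; case: eqP => [->|_]; last exact: mono_ge0.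
by rewrite mlcm_set0 => w _; apply/mnm_lepP => i; rewrite mnm0E.
Qed.

Section Subcomplex.

Variable Omega : {set {set 'I_q}}.
Local Notation T := (taylor_mod k n Omega).

Definition tembed (a : T) : ext Q q :=
  [ffun t => if insub t is Some s then a s * 'X_[lcm t] else 0].

Lemma tembedE a (s : {s | s \in Omega}) : tembed a (val s) = a s * 'X_[lcm (val s)].
Proof. by rewrite ffunE valK. Qed.

Lemma tembed_notin a t : t \notin Omega -> tembed a t = 0.
Proof. by move=> tO; rewrite ffunE insubN. Qed.

Lemma tembed_is_linear : linear tembed.
Proof.
move=> c a b; apply/ffunP => t; rewrite !ffunE.
case: insub => [s|]; last by rewrite scaler0 addr0.
by rewrite !ffunE mulrDl -mulrA.
Qed.
HB.instance Definition _ :=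
  GRing.isLinear.Build Q T (ext Q q) *:%R tembed tembed_is_linear.

Lemma tembed_inj : injective tembed.
Proof.
move=> a b ab; apply/ffunP => s; move/ffunP/(_ (val s)): ab.
by rewrite !tembedE; apply: mulIf; rewrite -msupp_eq0 msuppX.
Qed.

(** Inverse to [tembed] on its image; elsewhere the value has no meaning. *)
Definition tlift (x : ext Q q) : T := [ffun s => mono_div (lcm (val s)) (x (val s))].

Lemma tliftK x : supported (fun t => t \in Omega) x -> lcm_divisible x ->
  tembed (tlift x) = x.
Proof.
move=> Ox Cx; apply/ffunP => t; have [tO|tO] := boolP (t \in Omega).
  have := tembedE (tlift x) (exist _ t tO); rewrite /= => ->.
  by rewrite ffunE mono_divK.
by rewrite tembed_notin //; apply/esym/eqP/negPn; apply: contra tO; apply: Ox.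
Qed.

Lemma tembed_supported a : supported (fun t => t \in Omega) (tembed a).
Proof. by move=> t; apply: contraNT => /tembed_notin->. Qed.

Lemma tembed_divisible a : lcm_divisible (tembed a).
Proof.
move=> t; rewrite ffunE; case: insubP => [s _ _|_]; last exact: mono_ge0.
rewrite -[lcm t]add0m; apply: mono_geM; last by rewrite add0m; apply: mono_geX.
by move=> w _; apply/mnm_lepP => i; rewrite mnm0E.
Qed.

Lemma tembed_deg i a : ext_deg i (tembed a) <-> taylor_deg i a.
Proof.
split=> da s.
  move=> as0; apply: da; rewrite tembedE mulf_neq0 //.
  by rewrite -msupp_eq0 msuppX.
rewrite ffunE; case: insubP => [t _ <-|_]; last by rewrite eqxx.
by move=> at0; apply: da; apply: contra_neq at0 => ->; rewrite mul0r.
Qed.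

Lemma tembed_eps t : t \in Omega ->
  tembed (taylor_eps k n Omega t) = 'X_[lcm t] *: ebas Q t.
Proof.
move=> tO; apply/ffunP => s; rewrite ext_scaleE ebasE.
have [sO|sO] := boolP (s \in Omega).
  have := tembedE (taylor_eps k n Omega t) (exist _ s sO); rewrite /= => ->.
  by rewrite ffunE /=; have [->|_] := eqVneq s t; rewrite ?mul0r ?mulr0 ?mul1r ?mulr1.
rewrite tembed_notin //; case: eqP => [st|]; rewrite ?mulr0 //.
by rewrite -st (negbTE sO) in tO.
Qed.

Lemma taylor_expand (a : T) : a = \sum_s a s *: taylor_eps k n Omega (val s).
Proof.
apply/ffunP => t; rewrite sum_ffunE (bigD1 t) //= big1 ?addr0 => [|s st].
  by rewrite !ffunE eqxx /GRing.scale /= mulr1.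
by rewrite !ffunE val_eqE eq_sym (negbTE st) scaler0.
Qed.

Hypothesis Omega_down : forall s t : {set 'I_q}, s \subset t -> t \in Omega -> s \in Omega.

(** The monomial quotient at [j] times X^(lcm (s - j)) is X^(lcm s), so only signs remain. Closure
    under subsets keeps [taylor_eps] of s - j from being the default zero. *)
Lemma tembed_d a : tembed (taylor_diff m a) = ext_d (tembed a).
Proof.
rewrite [in RHS](taylor_expand a) /taylor_diff !linear_sum /=; apply: eq_bigr => s _.
rewrite !linearZ /=; congr (_ *: _); rewrite tembed_eps ?(valP s) //.
rewrite !linearZ /= ext_d_bas linear_sum scaler_sumr /=; apply: eq_bigr => j js.
have sub : val s :\ j \subset val s by exact: subsetDl.
rewrite linearZ /= tembed_eps; last exact: Omega_down sub (valP s).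
rewrite !scalerA.
congr (_ *: _); rewrite -[LHS]mulrA -[X in _ * X = _]mpolyXD submK.
  by rewrite mulrC.
exact: mlcm_setS.
Qed.

(** Transports the exterior product, followed by [pi], along the injection [tembed]. With [pi] the
    identity this gives the full Taylor complex, with [pi] a [retract] a proper pivot complex. *)
Lemma retract_dg_algebra (pi : {linear ext Q q -> ext Q q}) :
  set0 \in Omega ->
  is_complex (@taylor_deg k n q Omega) (@taylor_diff k n q m Omega) ->
  (forall i x, ext_deg i x -> ext_deg i (pi x)) ->
  (forall x, ext_d (pi x) = pi (ext_d x)) ->
  (forall x y, pi (ext_mul (pi x) y) = pi (ext_mul x y)) ->
  (forall x y, pi (ext_mul x (pi y)) = pi (ext_mul x y)) ->
  (forall x, supported (fun t => t \in Omega) (pi x)) ->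
  (forall x, supported (fun t => t \in Omega) x -> pi x = x) ->
  (forall x, lcm_divisible x -> lcm_divisible (pi x)) ->
  has_dg_algebra_structure (@taylor_deg k n q Omega) (@taylor_diff k n q m Omega).
Proof.
move=> O0 cpx pideg pid pil pir piO piid pidiv.
have [mul mulE] : exists mul : T -> T -> T,
    forall a b, tembed (mul a b) = pi (ext_mul (tembed a) (tembed b)).
  exists (fun a b => tlift (pi (ext_mul (tembed a) (tembed b)))) => a b.
  by apply: tliftK (piO _) _; apply/pidiv/lcm_divisible_mul; apply: tembed_divisible.
have [one oneE] : exists one : T, tembed one = ebas Q set0.
  exists (tlift (ebas Q set0)); apply: tliftK lcm_divisible1 => t; rewrite ebasE.
  by have [->|] := eqVneq t set0; rewrite ?eqxx.
have tembedZ c a : tembed (c *: a) = c *: tembed a by exact: linearZ.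
have piP c x y : pi (c *: x + y) = c *: pi x + pi y by exact: linearP.
(* Both bracketings equal [pi] of the triple product, since an inner [pi] is absorbed by the outer
   one. *)
have piA x y z : pi (ext_mul (pi (ext_mul x y)) z) = pi (ext_mul x (pi (ext_mul y z))).
  exact: etrans (pil _ _) (etrans (congr1 pi (ext_mulA x y z)) (esym (pir _ _))).
have piE a : pi (tembed a) = tembed a by apply/piid/tembed_supported.
exists mul, one; split.
- exact: cpx.
- move=> r a a' b; apply: tembed_inj.
  by rewrite mulE !tembed_is_linear ext_mul_lin piP !mulE.
- move=> r a b b'; apply: tembed_inj.
  by rewrite mulE !tembed_is_linear ext_mul_is_linear piP !mulE.
- move=> i j a b /tembed_deg da /tembed_deg db; apply/tembed_deg; rewrite mulE.
  exact: (pideg _ _ (ext_deg_mul da db)).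
- apply/tembed_deg; rewrite oneE => t; rewrite ebasE.
  by have [->|] := eqVneq t set0; rewrite ?cards0 ?eqxx.
- move=> i a _; split; apply: tembed_inj; rewrite mulE oneE.
    by rewrite ext_mul1r piE.
  by rewrite ext_mul1l piE.
- move=> i j a b /tembed_deg da /tembed_deg db; apply: tembed_inj.
  by rewrite tembedZ !mulE (ext_mul_comm da db) linearZ.
- move=> i a /tembed_deg da oi; apply: tembed_inj.
  by rewrite mulE (ext_mul_sqr0 da oi) !linear0.
- move=> i j l a b c _ _ _; apply: tembed_inj.
  rewrite (mulE (mul a b) c) (mulE a b) (mulE a (mul b c)) (mulE b c).
  exact: piA.
- move=> i j a b /tembed_deg da _; apply: tembed_inj.
  rewrite tembed_d mulE pid ext_leibniz (ext_inv_deg da) ext_mulZl addrC piP.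
  by rewrite [in RHS]addrC tembed_is_linear !mulE !tembed_d.
Qed.

End Subcomplex.
End Embedding.

(** * Exactness of the Taylor complex *)

Section TaylorResolution.

Variables (k : fieldType) (n q : nat) (m : 'I_q -> 'X_{1..n}).
Local Notation Q := {mpoly k[n]}.
Local Notation lcm := (mlcm_set m).

(** A choice depending on [u] alone sorts the monomials into disjoint classes, so the corresponding
    parts of a polynomial add up to it. *)
Definition least_divisor (u : 'X_{1..n}) : option 'I_q := [pick i | (m i <= u)%MM].

Definition least_divisor_part (v : 'I_q) : {additive Q -> Q} :=
  mono_filter (fun u => least_divisor u == Some v).

Lemma sum_least_divisor_part (f : Q) :
  (forall u, f@_u != 0 -> exists i, (m i <= u)%MM) ->
  \sum_v least_divisor_part v f = f.
Proof.
move=> fm; apply/mpolyP => u; rewrite raddf_sum /=.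
under eq_bigr => v _ do rewrite mcoeff_mono_filter.
have [f0|fu] := eqVneq f@_u 0; first by rewrite f0 big1 // => v _; rewrite if_same.
have [v lv] : exists v, least_divisor u = Some v.
  rewrite /least_divisor; case: pickP => [v _|none]; first by exists v.
  by have [i] := fm _ fu; rewrite none.
rewrite lv (bigD1 v) //= eqxx big1 ?addr0 // => w wv.
by case: eqP => // -[vw]; rewrite vw eqxx in wv.
Qed.

Lemma least_divisor_part_neq0 v f u : (least_divisor_part v f)@_u != 0 ->
  (m v <= u)%MM /\ f@_u != 0.
Proof.
rewrite /= mcoeff_mono_filter /least_divisor.
case: pickP => [w wu|_]; rewrite ?eqxx //.
by rewrite (inj_eq Some_inj); have [<-|_] := eqVneq w v; rewrite ?eqxx.
Qed.

(** The preimage is the split homotopy of these parts. Its coefficient at [t] stays divisible by lcm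
    t: a monomial coming from t - v is divisible by lcm (t - v) and, by the sorting, by m_v. Degree
    0 is included in order to compute H_0. *)
Lemma ext_exact_of_divisors i (x : ext Q q) : ext_deg i x -> lcm_divisible m x ->
  (forall t u, (x t)@_u != 0 -> exists i, (m i <= u)%MM) -> ext_d x = 0 ->
  exists y, [/\ ext_deg i.+1 y, lcm_divisible m y & ext_d y = x].
Proof.
move=> degx Cx xm dx; exists (split_homotopy least_divisor_part x); split.
- exact: split_homotopy_deg.
- apply: (split_homotopy_sub (graded_mono_ge k m)) => v t vt u.
  case/least_divisor_part_neq0 => vu /Cx su.
  apply/mlcm_setP => j jt; have [->//|jv] := eqVneq j v.
  by apply: lepm_trans su; apply: lem_mlcm_set; rewrite !inE jv.
apply: etrans (ext_d_split_homotopy _ dx) _; apply/ffunP => t.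
rewrite ext_sumE -[RHS](sum_least_divisor_part (xm t)).
by apply: eq_bigr => v _; rewrite ffunE.
Qed.

Lemma ext_exact i (x : ext Q q) : ext_deg i.+1 x -> lcm_divisible m x -> ext_d x = 0 ->
  exists y, [/\ ext_deg i.+2 y, lcm_divisible m y & ext_d y = x].
Proof.
move=> degx Cx dx; apply: ext_exact_of_divisors => // t u xtu.
have : (0 < #|t|)%N by rewrite degx //; apply: contra_neq xtu => ->; rewrite mcoeff0.
case/card_gt0P => j jt; exists j.
exact: lepm_trans (lem_mlcm_set m jt) (Cx _ _ xtu).
Qed.

(** * Grading, freeness and the complex axioms *)

Section Complex.

Variable Omega : {set {set 'I_q}}.
Local Notation T := (taylor_mod k n Omega).

Lemma taylor_graded : is_graded (@taylor_deg k n q Omega).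
Proof.
split.
- by move=> i s; rewrite ffunE eqxx.
- move=> i r a b da db s; rewrite !ffunE.
  by have [->|/da//] := eqVneq (a s) 0; rewrite scaler0 add0r; apply: db.
- move=> a.
  (* Cardinalities run from 0 to [q], hence [q.+1] components. *)
  exists q.+1, (fun i => [ffun s : {s | s \in Omega} => if #|val s| == i then a s else 0]).
  split.
    by move=> i s; rewrite ffunE; have [|_] := eqVneq #|val s| i; rewrite ?eqxx.
  apply/ffunP => s; rewrite sum_ffunE.
  have sq : (#|val s| < q.+1)%N by rewrite ltnS -[q in (_ <= q)%N]card_ord max_card.
  rewrite (bigD1 (Ordinal sq)) //= ffunE eqxx big1 ?addr0 // => j js.
  rewrite ffunE; case: eqP => // sj; case/eqP: js; exact: val_inj.
move=> N c dc c0 i iN; apply/ffunP => s; rewrite [RHS]ffunE; apply/eqP/negPn/negP => cis.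
have si := dc _ _ cis; move/ffunP/(_ s): c0.
rewrite sum_ffunE [RHS]ffunE (bigD1 (Ordinal iN)) //= big1 ?addr0 => [/eqP|j ji].
  by rewrite (negbTE cis).
apply/eqP/negPn/negP => /dc js; case/eqP: ji; apply: val_inj.
by rewrite /= -si -js.
Qed.

Lemma taylor_free i : free_component (@taylor_deg k n q Omega) i.
Proof.
pose P := [set s : {s | s \in Omega} | #|val s| == i].
pose b (j : 'I_#|P|) : T := taylor_eps k n Omega (val (enum_val j)).
have bE (c : {ffun 'I_#|P| -> Q}) j : (\sum_l c l *: b l) (enum_val j) = c j.
  rewrite sum_ffunE; apply: etrans (bigD1 j isT) _; rewrite big1 /= => [|l lj].
    by rewrite addr0 !ffunE eqxx; apply: mulr1.
  rewrite !ffunE val_eqE (inj_eq enum_val_inj) eq_sym (negbTE lj).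
  exact: mulr0.
exists #|P|, b; split=> [j s|a da].
  rewrite ffunE val_eqE; have [->|_] := eqVneq s (enum_val j); last by rewrite eqxx.
  by have := enum_valP j; rewrite inE => /eqP.
exists [ffun j => a (enum_val j)]; split=> [|c ->]; last first.
  by apply/ffunP => j; rewrite ffunE bE.
apply/ffunP => s; have [sP|sP] := boolP (s \in P).
  by rewrite -(enum_rankK_in sP sP) bE ffunE.
have -> : a s = 0 by apply/eqP/negPn; apply: contra sP => /da si; rewrite inE si.
rewrite sum_ffunE big1 // => j _; rewrite !ffunE val_eqE.
case: eqP => [sj|_]; last exact: mulr0.
by case/negP: sP; rewrite sj enum_valP.
Qed.

Hypothesis Omega_down : forall s t : {set 'I_q}, s \subset t -> t \in Omega -> s \in Omega.

Lemma taylor_complex :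
  is_complex (@taylor_deg k n q Omega) (@taylor_diff k n q m Omega).
Proof.
split.
- exact: taylor_graded.
- move=> r a b; rewrite /taylor_diff scaler_sumr -big_split /=.
  by apply: eq_bigr => s _; rewrite !ffunE scalerDl -scalerA.
- move=> i a /(tembed_deg m) da; apply/(tembed_deg m); rewrite tembed_d //.
  exact: ext_deg_d.
- move=> a da; apply: (@tembed_inj _ _ _ m); rewrite tembed_d // linear0.
  by apply: ext_deg_d0; apply/(tembed_deg m).
- move=> a; apply: (@tembed_inj _ _ _ m).
  by rewrite !tembed_d // ext_dd linear0.
Qed.

End Complex.
End TaylorResolution.

(** * Dickson's lemma *)

Section Dickson.

Variable n : nat.
Implicit Types (S : 'X_{1..n} -> Prop) (A : {set 'I_n}).

(** Induction on the set of compared coordinates. Drop a coordinate [i] to get a finite [B], and let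
    [c] be the largest [i]-th entry in [B]. Elements with [s i >= c] are dominated by [B]; the
    others lie in finitely many slices on which [s i] is constant, where the induction hypothesis
    applies again. *)
Lemma dickson_on A S : exists B : seq 'X_{1..n}, (forall b, b \in B -> S b) /\
  forall s, S s -> exists2 b, b \in B & forall i, i \in A -> (b i <= s i)%N.
Proof.
have [N] := ubnP #|A|; elim: N A S => // N IH A S AN.
have [->|[i iA]] := set_0Vmem A.
  (* With no coordinate left to compare, any one element of [S] suffices, if there is one. *)
  have [[s Ss]|nS] := classic (exists s, S s).
    exists [:: s]; split=> [b|t _]; first by rewrite inE => /eqP->.
    by exists s; rewrite ?inE // => j; rewrite inE.
  by exists [::]; split=> // s Ss; case: nS; exists s.
have AiN : (#|A :\ i| < N)%N by rewrite (cardsD1 i) iA in AN.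
have slices c : exists B : seq 'X_{1..n}, (forall b, b \in B -> S b) /\
    forall s, S s -> (s i < c)%N -> exists2 b, b \in B & forall j, j \in A -> (b j <= s j)%N.
  elim: c => [|c [B [BS Bs]]]; first by exists [::].
  have [B' [B'S B's]] := IH (A :\ i) (fun s => S s /\ s i = c) AiN.
  exists (B ++ B'); split=> [b|s Ss].
    by rewrite mem_cat => /orP[/BS|/B'S[]].
  rewrite ltnS leq_eqVlt => /orP[/eqP si|sc].
    have [b bB' bs] := B's s (conj Ss si); exists b; rewrite ?mem_cat ?bB' ?orbT // => j jA.
    have [->|ji] := eqVneq j i; last by apply: bs; rewrite !inE ji.
    by have [_ ->] := B'S _ bB'; rewrite si.
  by have [b bB bs] := Bs s Ss sc; exists b; rewrite ?mem_cat ?bB.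
have [B [BS Bs]] := IH (A :\ i) S AiN.
pose c := (\max_(b <- B) b i)%N.
have [B' [B'S B's]] := slices c.
exists (B ++ B'); split=> [b|s Ss]; first by rewrite mem_cat => /orP[/BS|/B'S].
have [sc|cs] := ltnP (s i) c.
  by have [b bB' bs] := B's s Ss sc; exists b; rewrite ?mem_cat ?bB' ?orbT.
have [b bB bs] := Bs s Ss; exists b; rewrite ?mem_cat ?bB // => j jA.
have [->|ji] := eqVneq j i; last by apply: bs; rewrite !inE ji.
by apply: leq_trans cs; rewrite /c (big_rem b) //= leq_maxl.
Qed.

Lemma dickson S : exists B : seq 'X_{1..n}, (forall b, b \in B -> S b) /\
  forall s, S s -> exists2 b, b \in B & (b <= s)%MM.
Proof.
have [B [BS Bs]] := dickson_on [set: 'I_n] S; exists B; split=> // s /Bs[b bB bs].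
by exists b => //; apply/mnm_lepP => i; apply: bs; rewrite inE.
Qed.

Lemma mdeg_lt (u v : 'X_{1..n}) : (u <= v)%MM -> u != v -> (mdeg u < mdeg v)%N.
Proof.
move=> uv; rewrite ltnNge; apply: contraNN => vu.
have /eqP : mdeg (v - u) = 0%N.
  by apply/eqP; rewrite -leqn0 -(leq_add2r (mdeg u)) -mdegD submK.
by rewrite mdeg_eq0 => /eqP d0; rewrite -(submK uv) d0 add0m.
Qed.

Definition minimal_in (B : seq 'X_{1..n}) (b : 'X_{1..n}) : bool :=
  all (fun c => (c <= b)%MM ==> (c == b)) B.

Lemma minimal_below (B : seq 'X_{1..n}) b : b \in B ->
  exists c, [/\ c \in B, minimal_in B c & (c <= b)%MM].
Proof.
have [N] := ubnP (mdeg b); elim: N b => // N IH b bN bB.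
have [mb|] := boolP (minimal_in B b); first by exists b; split=> //; apply: lepm_refl.
case/allPn => c cB; rewrite negb_imply => /andP[cb cneb].
have [|d [dB md dc]] := IH c _ cB; first exact: leq_trans (mdeg_lt cb cneb) bN.
by exists d; split=> //; apply: lepm_trans dc cb.
Qed.

Lemma minimal_generators_exist (k : fieldType) (I : {mpoly k[n]} -> Prop) :
  monomial_ideal I ->
  exists (q : nat) (m : 'I_q -> 'X_{1..n}), minimal_generators I m.
Proof.
move=> [S IS]; have [B [BS Bs]] := dickson S.
(* Minimality of the generators compares indices, so a repeated monomial would violate it; hence
   [undup]. *)
pose G := [seq b <- undup B | minimal_in B b].
have GB b : (b \in G) = minimal_in B b && (b \in B) by rewrite mem_filter mem_undup.
have uG : uniq G by rewrite filter_uniq ?undup_uniq.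
exists (size G), (fun i => nth 0%MM G i); split=> [f|i].
  apply: iff_trans (IS f) _; rewrite !monomial_spanP; split=> fS u /fS[s].
    move=> /Bs[b /minimal_below[c [cB mc cb]] bs] su.
    have cG : c \in G by rewrite GB mc.
    exists c; last exact: lepm_trans cb (lepm_trans bs su).
    have cl : (index c G < size G)%N by rewrite index_mem.
    by exists (Ordinal cl); rewrite /= nth_index.
  move=> [i ->] su; exists (nth 0%MM G i) => //; apply: BS.
  by have := mem_nth 0%MM (ltn_ord i); rewrite GB => /andP[].
rewrite monomial_spanP => /(_ (nth 0%MM G i)); rewrite mcoeffX eqxx oner_eq0.
case=> // s [j ji ->] ji'; case/negP: ji; apply/eqP/val_inj/eqP.
rewrite -(nth_uniq 0%MM (ltn_ord j) (ltn_ord i) uG).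
have := mem_nth 0%MM (ltn_ord i); rewrite GB => /andP[/allP mi _].
apply: (implyP (mi _ _)) ji'.
by have := mem_nth 0%MM (ltn_ord j); rewrite GB => /andP[].
Qed.

End Dickson.

(** * Pivot resolutions *)

Section PivotResolutions.

Variables (k : fieldType) (n q : nat) (m : 'I_q -> 'X_{1..n}).
Local Notation Q := {mpoly k[n]}.
Local Notation lcm := (mlcm_set m).
Variable I : Q -> Prop.
Hypothesis Igen : forall f, I f <-> monomial_span (fun u => exists i, u = m i) f.

Lemma mem_idealP f : I f <-> forall u, f@_u != 0 -> exists i, (m i <= u)%MM.
Proof.
apply: iff_trans (Igen f) _; rewrite monomial_spanP.
split=> fI u /fI; first by move=> [_ [i ->] iu]; exists i.
by move=> [i iu]; exists (m i) => //; exists i.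
Qed.

(** * The full Taylor complex as a resolution *)

Local Notation T := (taylor_mod k n [set: {set 'I_q}]).

(** The lift of F_0 -> Q/I to a map into [Q]; as the lcm of the empty set is 1, it reads off the
    coefficient at the empty set. *)
Definition augmentation (a : T) : Q^o := tembed m a set0.

Lemma augmentation_is_linear : linear augmentation.
Proof. by move=> c a b; rewrite /augmentation tembed_is_linear !ffunE. Qed.
HB.instance Definition _ :=
  GRing.isLinear.Build Q T Q^o *:%R augmentation augmentation_is_linear.

Let tliftTK (x : ext Q q) : lcm_divisible m x -> tembed m (tlift m [set: {set 'I_q}] x) = x.
Proof. by apply: tliftK => t _; rewrite inE. Qed.

Let downT (s t : {set 'I_q}) :
  s \subset t -> t \in [set: {set 'I_q}] -> s \in [set: {set 'I_q}].
Proof. by rewrite !inE. Qed.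

Lemma augmentation_surjective (f : Q) : exists2 a, taylor_deg 0 a & f = augmentation a.
Proof.
have fE : tembed m (tlift m [set: {set 'I_q}] (f *: ebas Q set0)) = f *: ebas Q set0.
  apply: tliftTK => t; rewrite ext_scaleE -[lcm t]add0m.
  apply: mono_geM; last exact: lcm_divisible1.
  by move=> w _; apply/mnm_lepP => i; rewrite mnm0E.
exists (tlift m [set: {set 'I_q}] (f *: ebas Q set0)).
  apply/(tembed_deg m); rewrite fE => s; rewrite ext_scaleE ebasE.
  by have [->|_] := eqVneq s set0; rewrite ?cards0 // mulr0 eqxx.
by rewrite /augmentation fE ext_scaleE ebasE eqxx mulr1.
Qed.

Lemma augmentation_kernel (a : T) : taylor_deg 0 a ->
  I (augmentation a) <-> exists2 b, taylor_deg 1 b & a = taylor_diff m b.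
Proof.
move=> /(tembed_deg m) da; rewrite mem_idealP; split=> [aI|[b _ ->] u].
  (* In degree 0 every element is a cycle, and membership in [I] is exactly the divisor
     condition. *)
  have [t u tau|y [dy Cy ay]] :=
    ext_exact_of_divisors da (@tembed_divisible _ _ _ m _ a) _ (ext_deg_d0 da).
    apply: (aI u); suff t0 : t = set0 by rewrite /augmentation -t0.
    apply/eqP; rewrite -cards_eq0 (da t) //; apply: contra_neq tau => ->; exact: mcoeff0.
  exists (tlift m [set: {set 'I_q}] y); first by apply/(tembed_deg m); rewrite tliftTK.
  by apply: (@tembed_inj _ _ _ m); rewrite (tembed_d m downT) tliftTK.
rewrite /augmentation (tembed_d m downT).
(* Membership in [I], the same condition at every [t]: each contribution to a boundary at [t] comes
   from some j + t and is divisible by m_j. *)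
pose C (t : {set 'I_q}) (f : Q) := forall u, f@_u != 0 -> exists i, (m i <= u)%MM.
have CC : graded_subgroups C.
  split=> [t w|t f g Cf Cg w|t f Cf w]; rewrite ?mcoeff0 ?eqxx //.
    by rewrite mcoeffD; have [->|/Cf//] := eqVneq f@_w 0; rewrite add0r; apply: Cg.
  by rewrite mcoeffN oppr_eq0; apply: Cf.
apply: (ext_d_sub CC) => t j _ _ w bw; exists j.
by apply: lepm_trans (@tembed_divisible _ _ _ m _ b _ _ bw); apply/lem_mlcm_set/setU11.
Qed.

Lemma taylor_exact i (a : T) : taylor_deg i.+1 a -> taylor_diff m a = 0 ->
  exists2 b, taylor_deg i.+2 b & a = taylor_diff m b.
Proof.
move=> /(tembed_deg m) da a0.
have d0 : ext_d (tembed m a) = 0 by rewrite -(tembed_d m downT) a0 linear0.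
have [y [dy Cy ay]] := ext_exact da (@tembed_divisible _ _ _ m _ a) d0.
exists (tlift m [set: {set 'I_q}] y); first by apply/(tembed_deg m); rewrite tliftTK.
by apply: (@tembed_inj _ _ _ m); rewrite (tembed_d m downT) tliftTK.
Qed.

Lemma taylor_resolution : is_free_resolution
  (@taylor_deg k n q [set: {set 'I_q}]) (@taylor_diff k n q m [set: {set 'I_q}]) I.
Proof.
split.
- exact: taylor_complex downT.
- exact: taylor_free.
- exists augmentation; split=> [f|a]; last exact: augmentation_kernel.
  have [a da ->] := augmentation_surjective f; exists a => //.
  by rewrite subrr mem_idealP => u; rewrite mcoeff0 eqxx.
exact: taylor_exact.
Qed.

(** * Proper pivot complexes *)

Section PivotSet.

Variable S : {set 'I_q}.
Let Omega := [set s : {set 'I_q} | ~~ (S \subset s)].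

Let downS (s t : {set 'I_q}) : s \subset t -> t \in Omega -> s \in Omega.
Proof. by rewrite !inE => st; apply: contra => /subset_trans->. Qed.

(** Write d eps_S = d b with [b] in the pivot complex. Then eps_S - b is a cycle of the Taylor
    complex, hence d y. Its coefficient at [S] is X^(lcm S) after embedding, and this monomial must
    occur in the coefficient of [y] at some v + S, which is divisible by m_v. *)
Lemma pivot_divisor : (2 <= #|S|)%N ->
  is_free_resolution (@taylor_deg k n q Omega) (@taylor_diff k n q m Omega) I ->
  exists2 v, v \notin S & (m v <= lcm S)%MM.
Proof.
move=> S2 res.
pose xS : ext Q q := 'X_[lcm S] *: ebas Q S.
have degS : ext_deg #|S| xS.
  by move=> s; rewrite ext_scaleE ebasE; have [->//|_] := eqVneq s S; rewrite mulr0 eqxx.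
have divS : lcm_divisible m xS.
  move=> s; rewrite ext_scaleE ebasE; have [->|_] := eqVneq s S.
    by rewrite mulr1; apply: mono_geX.
  by rewrite mulr0; apply: mono_ge0.
(* Two elements in [S] put d eps_S in positive degree, where the pivot complex is exact. *)
have [i Si] : exists i, #|S| = i.+2 by case: #|S| S2 => [|[|i]] // _; exists i.
rewrite Si in degS.
have zO : supported (fun t => t \in Omega) (ext_d xS).
  move=> t /ext_d_neq0[j jt]; rewrite ext_scaleE ebasE inE.
  have [<- _|_] := eqVneq (j |: t) S; last by rewrite mulr0 eqxx.
  by apply: contra jt => /subsetP; apply; apply: setU11.
have zE := tliftK zO (lcm_divisible_d divS).
set z := tlift m Omega (ext_d xS) in zE.
have [b /(tembed_deg m) db zb] : exists2 b, taylor_deg i.+2 b & z = taylor_diff m b.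
  apply: (resolution_exact res).
    by apply/(tembed_deg m); rewrite zE; apply: ext_deg_d.
  by apply: (@tembed_inj _ _ _ m); rewrite (tembed_d m downS) zE ext_dd linear0.
have d0 : ext_d (xS - tembed m b) = 0.
  by rewrite linearB /= -zE zb (tembed_d m downS) subrr.
have [y [_ Cy xy]] := ext_exact (supportedB degS db)
  (lcm_divisibleB divS (@tembed_divisible _ _ _ m _ b)) d0.
case: (pickP (fun v => (v \notin S) && (m v <= lcm S)%MM)) => [v /andP[]|none].
  by exists v.
(* This family constrains a single monomial at the single set [S]. *)
pose C (t : {set 'I_q}) (f : Q) := t = S -> f@_(lcm S) = 0.
have CC : graded_subgroups C.
  split=> [t _|t f g Cf Cg tS|t f Cf tS]; first exact: mcoeff0.
    by rewrite mcoeffD Cf // Cg // addr0.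
  by rewrite mcoeffN Cf // oppr0.
have yS : (ext_d y S)@_(lcm S) = 0.
  apply: (ext_d_sub CC) (erefl S) => t j jt _ tS; rewrite tS in jt *.
  apply/eqP/negPn/negP => /Cy /mlcm_setP/(_ j (setU11 _ _)) jS.
  by have := none j; rewrite jt jS.
have bS : tembed m b S = 0 by rewrite tembed_notin // inE negbK.
move/eqP: yS; rewrite xy ffunE ext_scaleE ebasE eqxx mulr1 [X in _ + X]ffunE bS subr0.
by rewrite mcoeffX eqxx oner_eq0.
Qed.

Lemma pivot_dg_algebra : (2 <= #|S|)%N ->
  is_free_resolution (@taylor_deg k n q Omega) (@taylor_diff k n q m Omega) I ->
  has_dg_algebra_structure (@taylor_deg k n q Omega) (@taylor_diff k n q m Omega).
Proof.
move=> S2 res; have [v vS vm] := pivot_divisor S2 res.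
have inO (x : ext Q q) : supported (fun t => t \in Omega) x <->
    supported (fun t => ~~ (S \subset t)) x.
  by split=> xO t /xO; rewrite inE.
apply: (@retract_dg_algebra _ _ _ _ _ downS (retract S v)).
- by rewrite inE subset0; apply: contraTneq S2 => ->; rewrite cards0.
- exact: resolution_complex res.
- exact: retract_deg.
- exact: retract_d.
- exact: retract_mull.
- exact: retract_mulr.
- by move=> x; apply/inO/retract_supported.
- by move=> x /inO; apply: retract_id.
- by move=> x; apply: lcm_divisible_retract.
Qed.

End PivotSet.

Lemma taylor_dg_algebra : has_dg_algebra_structure
  (@taylor_deg k n q [set: {set 'I_q}]) (@taylor_diff k n q m [set: {set 'I_q}]).
Proof.
apply: (@retract_dg_algebra _ _ _ _ _ downT idfun) => //.
  by rewrite inE.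
exact: taylor_complex downT.
by move=> x t _; rewrite inE.
Qed.

End PivotResolutions.

Theorem theorem1p1 (k : fieldType) (n : nat) (I : {mpoly k[n]} -> Prop)
    (hI : monomial_ideal I) :
  (exists (q : nat) (m : 'I_q -> 'X_{1..n}), minimal_generators I m) /\
  forall (q : nat) (m : 'I_q -> 'X_{1..n}), minimal_generators I m ->
    (exists Omega : {set {set 'I_q}}, is_pivot_resolution m I Omega) /\
    forall Omega : {set {set 'I_q}}, is_pivot_resolution m I Omega ->
      has_dg_algebra_structure (@taylor_deg k n q Omega) (@taylor_diff k n q m Omega).
Proof.
split=> [|q m [Igen _]]; first exact: minimal_generators_exist.
split=> [|Omega [[->|[S S2 ->]] res]].
- by exists [set: {set 'I_q}]; split; [left|apply: taylor_resolution].
- exact: taylor_dg_algebra.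
- exact: pivot_dg_algebra res.
Qed.
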